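(* Let $(\lambda_n)_{n\ge1}\subset\mathbb R^d$ be a betting strategy, with associated processes $L_n^{\rm H}(\lambda)$ and $W_n^{\rm H}$ as defined in the context. Assume that the regret $\mathcal R_n:=\max_{\lambda\in\mathbb R^d}\log L_n^{\rm H}(\lambda)-\log W_n^{\rm H}$ satisfies $\rho:=\sum_{n\ge1}\mathbb P[\mathcal R_n>r_n]<+\infty$ for some nonnegative sequence $(r_n)_{n\ge1}$. Let $(m_n)_{n\ge1}$ be a nonnegative sequence and suppose that $$\varrho_1:=\sum_{n\ge1}\mathbb P[\|\mu_n\|_2<m_n]<+\infty .$$ Set $$u_n:=\frac{2n\big(m_n-2D\sqrt{\log(n)/n}\big)_+^2}{D^2}-r_n,\qquad n\ge1 .$$ Then $$\sum_{n\ge1}\mathbb P[\log W_n^{\rm H}<u_n]\le\rho+\varrho_1+\frac{\pi^2}{3}<+\infty.$$ Hence $\liminf_{n\to+\infty}\frac{\log W_n^{\rm H}}{u_n}\ge1$ $\mathbb P$-a.s., and for any $\alpha\in(0,1)$, $$\mathbb E[\tau_\alpha^{\rm H}]\le\rho+\varrho_1+\frac{\pi^2}{3}+\aleph\big((u_n)_{n\ge1},\log(1/\alpha)\big).$$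
   Context: Let $(\Omega,\mathcal F,\mathbb P)$ be a probability space with filtration $(\mathcal F_t)_{t\in\mathbb N}$, and write $\mathbb E_{t-1}[\cdot]=\mathbb E[\cdot\mid\mathcal F_{t-1}]$. $(X_t)_{t\in\mathbb N}$ is an adapted process valued in a bounded set $\mathsf X\subset\mathbb R^d$, $d\ge1$, with diameter $D:=\sup_{x,y\in\mathsf X}\|x-y\|_2$. Put $\mu_n:=\frac1n\sum_{t=1}^n\mathbb E_{t-1}[X_t]$. A betting strategy is a predictable sequence $(\lambda_n)_{n\ge1}$ ($\lambda_n$ is $\mathcal F_{n-1}$-measurable). For $\lambda\in\mathbb R^d$, $$L_n^{\rm H}(\lambda)=\prod_{t=1}^n\exp\big(\lambda^\top X_t-\|\lambda\|_2^2D^2/8\big),\qquad W_n^{\rm H}=\prod_{t=1}^n\exp\big(\lambda_t^\top X_t-\|\lambda_t\|_2^2D^2/8\big),\quad n\in\mathbb N .$$ The sequences $(r_n)$, $(m_n)$ are deterministic. Also $\tau_\alpha^{\rm H}:=\inf\{n\in\mathbb N:W_n^{\rm H}\ge1/\alpha\}$, $z_+=\max(z,0)$, and $\aleph((u_n)_{n\ge1},x):=\inf\{n\ge1:\inf_{k\ge n}u_k\ge x\}$ (with $\inf\emptyset=+\infty$).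
   Formalization: The liminf claim is stated under the added assumption that u_n > 0 for all large n; without it the ratio may be undefined or the claim false (e.g. λ_n = 0, m_n = 0, r_n = Cn with C large gives ratio 0). *)

(* Defs.v *)
From HB Require Import structures.
From mathcomp Require Import all_boot all_order all_algebra.
From mathcomp Require Import all_classical all_reals all_analysis.

Set Implicit Arguments.
Unset Strict Implicit.
Unset Printing Implicit Defensive.

Import Order.TTheory GRing.Theory Num.Theory.
Import numFieldNormedType.Exports.

Local Open Scope classical_set_scope.
Local Open Scope ring_scope.

Definition dotp (R : realType) (d : nat) (u v : 'rV[R]_d) : R :=
  \sum_(j < d) u ord0 j * v ord0 j.

(* The norm `|x| of the library on 'rV[R]_d is the sup norm. *)
Definition norm2 (R : realType) (d : nat) (x : 'rV[R]_d) : R :=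
  Num.sqrt (dotp x x).

Definition diam2 (R : realType) (d : nat) (XX : set 'rV[R]_d) : R :=
  sup [set norm2 (x - y) | x in XX & y in XX].

Definition filtration (d : measure_display) (T : measurableType d)
    (F : nat -> set (set T)) : Prop :=
  (forall n, sigma_algebra setT (F n)) /\
  (forall n, F n `<=` @measurable d T) /\
  (forall n, F n `<=` F n.+1).

(* Measurability from the sigma-algebra G to the Borel sigma-algebra of R^d. *)
Definition Gmeasurable (T : Type) (R : realType) (d : nat)
    (G : set (set T)) (f : T -> 'rV[R]_d) : Prop :=
  forall B : set 'rV[R]_d, <<s open >> B -> G (f @^-1` B).

(* Y is a version of E[X | G]; integrals of vectors are componentwise. *)
Definition is_cond_exp (dd : measure_display) (T : measurableType dd)
    (R : realType) (P : probability T R) (d : nat) (G : set (set T))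
    (X Y : T -> 'rV[R]_d) : Prop :=
  [/\ Gmeasurable G Y,
      forall j, P.-integrable setT (fun w => (Y w ord0 j)%:E) &
      forall A, G A -> forall j,
        (\int[P]_(w in A) (Y w ord0 j)%:E = \int[P]_(w in A) (X w ord0 j)%:E)%E].

Definition WH (T : Type) (R : realType) (d : nat) (D : R)
    (X lam : nat -> T -> 'rV[R]_d) (n : nat) (w : T) : R :=
  \prod_(1 <= t < n.+1)
    expR (dotp (lam t w) (X t w) - norm2 (lam t w) ^+ 2 * D ^+ 2 / 8).

Definition LH (T : Type) (R : realType) (d : nat) (D : R)
    (X : nat -> T -> 'rV[R]_d) (l : 'rV[R]_d) (n : nat) (w : T) : R :=
  \prod_(1 <= t < n.+1)
    expR (dotp l (X t w) - norm2 l ^+ 2 * D ^+ 2 / 8).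

(* For n >= 1 the supremum is attained as soon as D != 0. *)
Definition regretH (T : Type) (R : realType) (d : nat) (D : R)
    (X lam : nat -> T -> 'rV[R]_d) (n : nat) (w : T) : \bar R :=
  (ereal_sup [set (ln (LH D X l n w))%:E | l in [set: 'rV[R]_d]]
   - (ln (WH D X lam n w))%:E)%E.

(* EX t stands for the conditional expectation of X_t given F_(t-1). *)
Definition mean_cond (T : Type) (R : realType) (d : nat)
    (EX : nat -> T -> 'rV[R]_d) (n : nat) (w : T) : 'rV[R]_d :=
  n%:R^-1 *: \sum_(1 <= t < n.+1) EX t w.

Definition uH (R : realType) (D : R) (r m : nat -> R) (n : nat) : R :=
  2 * n%:R * Num.max (m n - 2 * D * Num.sqrt (ln n%:R / n%:R)) 0 ^+ 2 / D ^+ 2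
  - r n.

(* ereal_inf set0 = +oo, which is the value of an infimum over no index in
   tauH and aleph. *)
Definition tauH (T : Type) (R : realType) (d : nat) (D : R)
    (X lam : nat -> T -> 'rV[R]_d) (alpha : R) (w : T) : \bar R :=
  ereal_inf [set n%:R%:E | n in [set n : nat | 1 / alpha <= WH D X lam n w]].

Definition aleph (R : realType) (u : nat -> R) (x : R) : \bar R :=
  ereal_inf [set n%:R%:E | n in
    [set n : nat | (1 <= n)%N /\
      (x%:E <= ereal_inf [set (u k)%:E | k in [set k | (n <= k)%N]])%E]].

(* Main.v *)
Require Import Defs.
From HB Require Import structures.
From mathcomp Require Import all_boot all_order all_algebra.
From mathcomp Require Import all_classical all_reals all_analysis.
From mathcomp Require Import measurable_realfun.
From mathcomp Require Import ring lra.

Set Implicit Arguments.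
Unset Strict Implicit.
Unset Printing Implicit Defensive.

Import Order.TTheory GRing.Theory Num.Theory.
Import numFieldNormedType.Exports.
Local Open Scope classical_set_scope.
Local Open Scope ring_scope.

(** The function l |-> ln (LH D X l n w) is a concave quadratic with maximum
    2 n |xbar|^2 / D^2, where xbar is the empirical mean of X_1, ..., X_n.
    Hence the log-wealth is at least this maximum minus the regret, and
    ln W_n < u_n forces one of three events: the regret exceeds r_n, or
    |mu_n| < m_n, or xbar is further than 2 D sqrt (ln n / n) from mu_n
    (ln_WH_ge).  The first two are summable by hypothesis.  The third has
    probability at most min(1, 2 / n^2) (mean_tail); these numbers sum to at
    most 3, by telescoping, and 3 <= pi^2 / 3 because 3 <= pi
    (sum_min_inv_sqr_le).
    If D = 0, then u_n = - r_n and the bet l = 0 alone shows that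
    ln W_n < u_n is contained in the first event.

    The deviation bound does not depend on the dimension.  It comes from the
    argument of Pinelis for martingales in a Hilbert space.  Since
    z |-> cosh (sqrt z) is convex, cosh |s + x| is at most
    cosh |s| * cosh c plus a multiple of the inner product of s and x, as soon
    as |x| <= c (coshR_norm2D).  If s is the value of a martingale and x its
    next increment, the linear term has expectation zero
    (Rintegral_orthogonal), so the expectation of cosh |S_n| is at most
    (cosh c)^n <= exp (n c^2 / 2) (expectation_coshR_le).  Rescaling the
    martingale and applying the Markov inequality give a Gaussian tail
    (norm2_tail).

    The increments are X_t - E[X_t | F_(t-1)].  A conditional expectation of a
    variable with values in XX is almost surely within distance diam2 XX of
    all points of XX, because it satisfies almost surely each of the
    countably many half-space constraints with rational normal that XX
    satisfies (cond_exp_near).  The exceptional event belongs to F_(t-1), so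
    setting the increment to zero there keeps it a martingale difference and
    makes its bound hold everywhere.

    Once the events ln W_n < u_n are known to be summable, the lower limit
    follows from the Borel-Cantelli lemma, and the bound on the hitting time
    from the remark that, for N such that u_n >= ln (1 / alpha) for n >= N,
    the hitting time is at most N plus the number of n >= N at which
    ln W_n < u_n (integral_first_time_le). *)

(** * Hyperbolic cosine, and a lower bound on pi *)

Definition coshR (R : realType) (x : R) : R := (expR x + expR (- x)) / 2.
Definition sinhR (R : realType) (x : R) : R := (expR x - expR (- x)) / 2.

Lemma coshR_cvg (R : realType) (x : R) :
  (fun n => (series (exp_coeff x) n + series (exp_coeff (- x)) n) / 2) @ \oo
    --> coshR x.
Proof.
apply: cvgM; last exact: cvg_cst.
by apply: cvgD; exact: is_cvg_series_exp_coeff.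
Qed.

(** Both cosh and its comparison with other functions are treated term by
    term: the odd terms of the exponential series cancel, and the even ones
    are increasing functions of x^2. *)
Lemma exp_coeffDN (R : realType) (x : R) (k : nat) :
  exp_coeff x k + exp_coeff (- x) k =
  if odd k then 0 else 2 * (x ^+ 2) ^+ k./2 / k`!%:R.
Proof.
rewrite /exp_coeff /=; case: ifPn => ok.
  by rewrite exprNn -signr_odd ok /= expr1 mulN1r mulNr subrr.
rewrite exprNn -signr_odd (negbTE ok) expr0 mul1r -exprM mul2n.
by rewrite even_halfK// -mulrDl mulr_natl mulr2n.
Qed.

Lemma convex_exprn (R : realType) (p q A B : R) (k : nat) :
  0 <= p -> 0 <= q -> p + q = 1 -> 0 <= A -> 0 <= B ->
  (p * A + q * B) ^+ k <= p * A ^+ k + q * B ^+ k.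
Proof.
move=> p0 q0 pq A0 B0; elim: k => [|k IH]; first by rewrite !expr0 !mulr1 pq.
rewrite exprS.
apply: (@le_trans _ _ ((p * A + q * B) * (p * A ^+ k + q * B ^+ k))).
  by rewrite ler_wpM2l// addr_ge0 ?mulr_ge0.
have h : 0 <= (A - B) * (A ^+ k - B ^+ k).
  have [AB|BA] := leP A B.
    by rewrite mulr_le0// subr_le0// lerXn2r ?nnegrE.
  by rewrite mulr_ge0// subr_ge0 ?lerXn2r ?nnegrE// ltW.
have qE : q = 1 - p by rewrite -pq addrAC subrr add0r.
rewrite -subr_ge0.
rewrite (_ : _ - _ = p * q * ((A - B) * (A ^+ k - B ^+ k))).
  by rewrite mulr_ge0// mulr_ge0.
by rewrite !exprS qE; ring.
Qed.

(** Convexity and monotonicity of z |-> cosh (sqrt z) at once: in the series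
    of cosh each term is a nonnegative multiple of a power of x^2, and powers
    are convex and nondecreasing on the nonnegative half-line. *)
Lemma coshR_jensen (R : realType) (p q a b z : R) :
  0 <= p -> 0 <= q -> p + q = 1 -> z ^+ 2 <= p * a ^+ 2 + q * b ^+ 2 ->
  coshR z <= p * coshR a + q * coshR b.
Proof.
move=> p0 q0 pq zab.
have ca := @coshR_cvg R a; have cb := @coshR_cvg R b.
have cz := @coshR_cvg R z.
apply: (ler_cvg_to cz (cvgD (cvgM (cvg_cst p) ca) (cvgM (cvg_cst q) cb))).
apply: nearW => n /=.
rewrite -[leRHS]/(
  p * ((series (exp_coeff a) n + series (exp_coeff (- a)) n) / 2)
  + q * ((series (exp_coeff b) n + series (exp_coeff (- b)) n) / 2)).
rewrite !mulrA -mulrDl ler_pM2r ?invr_gt0//.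
rewrite /series /= -!big_split/= !mulr_sumr -big_split/=.
apply: ler_sum => k _; rewrite !exp_coeffDN.
case: ifP => _; first by rewrite !mulr0 addr0.
rewrite !mulrA -mulrDl ler_pM2r ?invr_gt0 ?ltr0n ?fact_gt0//.
rewrite !(mulrC _ 2) -!mulrA -mulrDr ler_pM2l//.
apply: le_trans (convex_exprn _ p0 q0 pq (sqr_ge0 a) (sqr_ge0 b)).
by rewrite lerXn2r ?nnegrE ?sqr_ge0// addr_ge0// mulr_ge0// sqr_ge0.
Qed.

(** Term by term, this is 2^k k! <= (2k)!. *)
Lemma coshR_le_gauss (R : realType) (c : R) : coshR c <= expR (c ^+ 2 / 2).
Proof.
have cc := @coshR_cvg R c.
have ce : series (exp_coeff (c ^+ 2 / 2)) @ \oo --> expR (c ^+ 2 / 2).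
  exact: is_cvg_series_exp_coeff.
have h2 : (fun n => n.*2) @ \oo --> \oo.
  apply/cvgnyPge => A; near=> n; rewrite -addnn.
  by apply: leq_trans (leq_addr _ _); near: n; exact: nbhs_infty_ge.
apply: (ler_cvg_to (cvg_comp _ _ h2 cc) ce); apply: nearW => n /=.
rewrite ler_pdivrMr// /series /= -big_split/=.
elim: n => [|n IH]; first by rewrite double0 !big_nil mul0r.
rewrite doubleS big_nat_recr//= big_nat_recr//= [in leRHS]big_nat_recr//=.
rewrite mulrDl -addrA lerD// !exp_coeffDN /= odd_double /= addr0 doubleK.
rewrite mulrC /exp_coeff /= mulrC.
rewrite -[leRHS]mulrC -mulrA ler_pM2l// expr_div_n -mulrA ler_wpM2l//.
  by rewrite exprn_ge0// sqr_ge0.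
rewrite -invfM lef_pV2 ?posrE ?mulr_gt0 ?ltr0n ?fact_gt0 ?exprn_gt0//.
rewrite -natrX -natrM ler_nat.
elim: n {IH} => // n IH; rewrite doubleS !factS expnS.
rewrite (_ : (2 * 2 ^ n * (n.+1 * n`!) = (n.+1).*2 * (2 ^ n * n`!))%N).
  by rewrite -doubleS leq_mul// (leq_trans IH)// leq_pmull.
by rewrite mulnACA mul2n.
Unshelve. all: by end_near. Qed.

Lemma coshR_ge_halfexp (R : realType) (x : R) : expR x / 2 <= coshR x.
Proof. by rewrite ler_pM2r ?invr_gt0// lerDl expR_ge0. Qed.

Lemma coshR_mono (R : realType) (x y : R) :
  0 <= x -> x <= y -> coshR x <= coshR y.
Proof.
move=> x0 xy.
have := @coshR_jensen R 1 0 y 0 x ler01 (lexx _) (addr0 1).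
rewrite !mul1r !mul0r !addr0; apply.
by rewrite lerXn2r ?nnegrE// (le_trans x0).
Qed.

Lemma coshR_gt0 (R : realType) (x : R) : 0 < coshR x.
Proof. by rewrite divr_gt0// addr_gt0 ?expR_gt0. Qed.

Lemma coshR0 (R : realType) : coshR 0 = 1 :> R.
Proof. by rewrite /coshR oppr0 expR0; field. Qed.

Lemma norm_sinhR_le (R : realType) (x : R) : `|sinhR x| <= coshR x.
Proof.
rewrite /sinhR /coshR; have := expR_gt0 x; have := expR_gt0 (- x).
by rewrite ler_norml; lra.
Qed.

Lemma measurable_coshR (R : realType) : measurable_fun setT (@coshR R).
Proof.
apply: measurable_funM => //; apply: measurable_funD => //.
by apply: measurableT_comp => //; exact: measurable_funN.
Qed.

Lemma measurable_sinhR (R : realType) : measurable_fun setT (@sinhR R).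
Proof.
apply: measurable_funM => //; apply: measurable_funB => //.
by apply: measurableT_comp => //; exact: measurable_funN.
Qed.

Lemma coshRD (R : realType) (x y : R) :
  coshR (x + y) = coshR x * coshR y + sinhR x * sinhR y.
Proof. by rewrite /coshR /sinhR opprD !expRD; field. Qed.

Lemma coshRB (R : realType) (x y : R) :
  coshR (x - y) = coshR x * coshR y - sinhR x * sinhR y.
Proof. by rewrite /coshR /sinhR opprB addrC !expRD; field. Qed.

(** The duplication formula gives cos (pi / 3) = 1 / 2, while
    cos 1 = 2 cos (1/2)^2 - 1 >= 1 / 2 because sin x <= x; since cos
    decreases on [0, pi], 1 <= pi / 3. *)
Lemma pi_ge3 (R : realType) : (3 : R) <= pi.
Proof.
have sinle (x : R) : 0 <= x -> sin x <= x.
  move=> x0.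
  have [z z0 E] : exists2 z, z \in `[0, x] & sin x - sin 0 = cos z * (x - 0).
    apply: (@MVT_segment R sin cos 0 x x0).
    by apply: continuous_subspaceT => y; exact: continuous_sin.
  rewrite sin0 !subr0 in E; by rewrite E -[leRHS]mul1r ler_wpM2r// cos_le1.
have c1 : 1 / 2 <= cos (1 : R).
  have -> : cos (1 : R) = cos ((1 / 2) *+ 2).
    by congr cos; rewrite mulr2n; field.
  rewrite cos_mulr2n; set c := cos _.
  have s0 : 0 <= sin (1 / 2 : R) by apply: sin_ge0_pi; have := @pi_ge2 R; lra.
  have s1 := sinle (1 / 2) ltac:(lra).
  have : sin (1 / 2 : R) ^+ 2 <= (1 / 2) ^+ 2 by rewrite lerXn2r ?nnegrE//; lra.
  have := cos2Dsin2 (1 / 2 : R); rewrite -/c => E1 E2.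
  by rewrite (mulr2n (c ^+ 2)); lra.
have c3 : cos (pi / 3 : R) = 1 / 2.
  have E : cos ((pi / 3) *+ 2) = - cos (pi / 3 : R).
    rewrite -(cosN (_ *+ 2)) -cosDpi -(cosD2pi (- _)).
    by congr cos; rewrite !mulr2n; field.
  rewrite cos_mulr2n (mulr2n (_ ^+ 2)) in E.
  have c0 : 0 < cos (pi / 3 : R).
    by apply: cos_gt0_pihalf; have := @pi_gt0 R; lra.
  have : (cos (pi / 3 : R) - 1 / 2) * (cos (pi / 3 : R) + 1) = 0 by nra.
  by move/eqP; rewrite mulf_eq0 => /orP[]/eqP; lra.
have : (1 : R) <= pi / 3.
  rewrite -c3 in c1; have pi2 := @pi_ge2 R; rewrite leNgt.
  apply/negP => lt1; move: c1; rewrite leNgt ltr_cos ?in_itv/= ?lt1//; lra.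
lra.
Qed.

(** * Euclidean geometry of row vectors *)

Section measurable_comparison.
Context {R : realType} {dd : measure_display} {T : measurableType dd}.
Variables f g : T -> R.
Hypotheses (mf : measurable_fun setT f) (mg : measurable_fun setT g).

Lemma measurable_lt_set : measurable [set w | f w < g w].
Proof.
have := measurable_fun_ltr mf mg.
by move=> /(_ measurableT [set true] I); rewrite setTI.
Qed.

Lemma measurable_le_set : measurable [set w | f w <= g w].
Proof.
have := measurable_fun_ler mf mg.
by move=> /(_ measurableT [set true] I); rewrite setTI.
Qed.

End measurable_comparison.

Section euclidean.
Context {R : realType} {d : nat}.
Implicit Types (u v x y : 'rV[R]_d) (a b c : R).

Lemma dotpC u v : dotp u v = dotp v u.
Proof. by apply: eq_bigr => j _; rewrite mulrC. Qed.

Lemma dotpDl u v x : dotp (u + v) x = dotp u x + dotp v x.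
Proof. by rewrite -big_split; apply: eq_bigr => j _; rewrite mxE mulrDl. Qed.

Lemma dotpZl a u v : dotp (a *: u) v = a * dotp u v.
Proof. by rewrite mulr_sumr; apply: eq_bigr => j _; rewrite mxE mulrA. Qed.

Lemma dotpDr u v x : dotp x (u + v) = dotp x u + dotp x v.
Proof. by rewrite !(dotpC x) dotpDl. Qed.

Lemma dotpZr a u v : dotp u (a *: v) = a * dotp u v.
Proof. by rewrite !(dotpC u) dotpZl. Qed.

Lemma dotpBr u v x : dotp x (u - v) = dotp x u - dotp x v.
Proof. by rewrite dotpDr -scaleN1r dotpZr mulN1r. Qed.

Lemma dotp0r u : dotp u 0 = 0.
Proof. by rewrite -(scale0r 0) dotpZr mul0r. Qed.

Lemma dotp_sumr (I : Type) (s : seq I) (P : pred I) u (F : I -> 'rV[R]_d) :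
  dotp u (\sum_(i <- s | P i) F i) = \sum_(i <- s | P i) dotp u (F i).
Proof. by apply: (big_morph (dotp u)) => [x y|]; rewrite ?dotpDr ?dotp0r. Qed.

Lemma dotp_ge0 u : 0 <= dotp u u.
Proof. by apply: sumr_ge0 => j _; rewrite -expr2 sqr_ge0. Qed.

Lemma norm2_ge0 u : 0 <= norm2 u.
Proof. exact: sqrtr_ge0. Qed.

Lemma sqr_norm2 u : norm2 u ^+ 2 = dotp u u.
Proof. by rewrite sqr_sqrtr// dotp_ge0. Qed.

Lemma norm2_eq0 u : norm2 u = 0 -> u = 0.
Proof.
move=> u0; apply/rowP => j; rewrite mxE.
have : dotp u u = 0 by rewrite -sqr_norm2 u0 expr0n.
move/eqP; rewrite psumr_eq0; last by move=> i _; rewrite -expr2 sqr_ge0.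
by move/allP => /(_ j (mem_index_enum _)); rewrite /= mulf_eq0 orbb => /eqP.
Qed.

Lemma norm2Z a u : norm2 (a *: u) = `|a| * norm2 u.
Proof.
by rewrite /norm2 dotpZl dotpZr mulrA -expr2 sqrtrM ?sqr_ge0// sqrtr_sqr.
Qed.

Lemma norm20 : norm2 (0 : 'rV[R]_d) = 0.
Proof. by rewrite -(scale0r 0) norm2Z normr0 mul0r. Qed.

Lemma norm2N u : norm2 (- u) = norm2 u.
Proof. by rewrite -scaleN1r norm2Z normrN1 mul1r. Qed.

Lemma sqr_norm2D u v :
  norm2 (u + v) ^+ 2 = norm2 u ^+ 2 + 2 * dotp u v + norm2 v ^+ 2.
Proof. by rewrite !sqr_norm2 dotpDl !dotpDr (dotpC v u); ring. Qed.

Lemma dotp_norm2 u v : `|dotp u v| <= norm2 u * norm2 v.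
Proof.
have [/norm2_eq0 ->|u0] := eqVneq (norm2 u) 0.
  by rewrite dotpC dotp0r normr0 mulr_ge0 ?norm2_ge0.
have [/norm2_eq0 ->|v0] := eqVneq (norm2 v) 0.
  by rewrite dotp0r normr0 mulr_ge0 ?norm2_ge0.
have up : 0 < norm2 u by rewrite lt_neqAle eq_sym u0 norm2_ge0.
have vp : 0 < norm2 v by rewrite lt_neqAle eq_sym v0 norm2_ge0.
have K w : w ^+ 2 = 1 -> 0 <= norm2 u * norm2 v + w * dotp u v.
  move=> w1; have := sqr_ge0 (norm2 (norm2 v *: u + (w * norm2 u) *: v)).
  rewrite sqr_norm2D !norm2Z dotpZl dotpZr !exprMn !real_normK ?num_real//.
  rewrite exprMn w1 mul1r.
  rewrite (_ : _ + _ + _ = 2 * (norm2 u * norm2 v) *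
    (norm2 u * norm2 v + w * dotp u v)); last by ring.
  by rewrite pmulr_rge0// mulr_gt0// mulr_gt0.
have := K 1 (expr1n _ _); have := K (- 1) (sqrr_sign _ 1).
by rewrite ler_norml; lra.
Qed.

Lemma norm2_triangle u v : norm2 (u + v) <= norm2 u + norm2 v.
Proof.
rewrite -(@ler_pXn2r _ 2) ?nnegrE ?addr_ge0 ?norm2_ge0// sqr_norm2D sqrrD.
rewrite lerD2r lerD2l mulr_natl ler_wMn2r//.
exact: le_trans (ler_norm _) (dotp_norm2 _ _).
Qed.

(** With v = s.x / (|s| c), which lies in [-1, 1], |s + x|^2 is at most the
    mean of (|s| + c)^2 and (|s| - c)^2 with weights (1 + v) / 2 and
    (1 - v) / 2; the convexity of z |-> cosh (sqrt z) and the addition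
    formulas for cosh conclude.  For s = 0 the convention 0^-1 = 0 makes the
    linear term vanish. *)
Lemma coshR_norm2D s x c : 0 < c -> norm2 x <= c ->
  coshR (norm2 (s + x)) <= coshR (norm2 s) * coshR c
    + sinhR (norm2 s) / norm2 s * (sinhR c / c) * dotp s x.
Proof.
move=> c0 xc; set a := norm2 s.
pose v := dotp s x / (a * c).
have [/norm2_eq0 s0|a0] := eqVneq a 0.
  rewrite /a s0 add0r norm20 dotpC dotp0r mulr0 addr0.
  rewrite coshR0 mul1r.
  exact: coshR_mono (norm2_ge0 _) xc.
have ap : 0 < a by rewrite lt_neqAle eq_sym a0 norm2_ge0.
have /andP[v1 v2] : -1 <= v <= 1.
  have acp : 0 < a * c by rewrite mulr_gt0.
  rewrite -ler_norml normrM normfV (gtr0_norm acp).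
  rewrite ler_pdivrMr// mul1r (le_trans (dotp_norm2 _ _))//.
  by rewrite ler_wpM2l// norm2_ge0.
have dE : dotp s x = v * (a * c) by rewrite /v divfK// mulf_neq0// gt_eqF.
have := @coshR_jensen R ((1 + v) / 2) ((1 - v) / 2) (a + c) (a - c)
  (norm2 (s + x)).
rewrite coshRD coshRB dE => /(_ _ _ _ _)/le_trans; apply.
- lra.
- lra.
- by field.
- rewrite sqr_norm2D dE -/a.
  have : norm2 x ^+ 2 <= c ^+ 2 by rewrite lerXn2r ?nnegrE ?norm2_ge0 ?(ltW c0).
  have -> : (1 + v) / 2 * (a + c) ^+ 2 + (1 - v) / 2 * (a - c) ^+ 2 =
    a ^+ 2 + 2 * (v * (a * c)) + c ^+ 2 by field.
  by move=> ?; rewrite lerD2l.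
- rewrite le_eqVlt; apply/orP; left; apply/eqP; field.
  by rewrite a0 gt_eqF.
Qed.

Lemma coord_le_norm2 u j : `|u ord0 j| <= norm2 u.
Proof.
rewrite -(@ler_pXn2r _ 2) ?nnegrE ?norm2_ge0// sqr_norm2 real_normK ?num_real//.
rewrite /dotp (bigD1 j)//= -expr2 lerDl sumr_ge0// => i _.
by rewrite -expr2 sqr_ge0.
Qed.

Lemma dotp_continuous u : continuous (dotp u).
Proof.
move=> v; apply: (@cvg_big _ _ _ _ _ _ _ (nbhs v)) => [|j _].
  exact: add_continuous.
by apply: cvgM; [exact: cvg_cst|exact: coord_continuous].
Qed.

Lemma norm2_continuous : continuous (@norm2 R d).
Proof.
move=> v; apply: (@continuous_comp _ _ _ (fun u => dotp u u) Num.sqrt);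
  last exact: sqrt_continuous.
apply: (@cvg_big _ _ _ _ _ _ _ (nbhs v)) => [|j _].
  exact: add_continuous.
by apply: cvgM; exact: coord_continuous.
Qed.

(** Used to replace suprema and constraints indexed by all vectors by
    countable ones. *)
Lemma dense_rat_row (U : set 'rV[R]_d) : open U -> U !=set0 ->
  exists q : 'rV[rat]_d, U (map_mx ratr q).
Proof.
move=> oU [x Ux].
have [P Px PU] : nbhs x U by exact: open_nbhs_nbhs.
have /choice[q Hq] : forall j : 'I_d, exists q : rat, P ord0 j (ratr q).
  move=> j; have : (P ord0 j)° !=set0.
    by exists (x ord0 j); rewrite /interior; exact: Px.
  move=> /(@dense_rat R _) /(_ (open_interior _)).
  move=> [y [/interior_subset Pq [q _ qE]]].
  by exists q; rewrite qE.
exists (\row_j q j); apply: PU => i j /=.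
by rewrite (ord1 i) !mxE.
Qed.

(** If b < |x|, the set of u with u.x > b |u| is open and contains x, hence
    contains a rational vector. *)
Lemma norm2_le_dual b x : 0 <= b ->
  (forall q : 'rV[rat]_d, let u := map_mx ratr q in dotp u x <= b * norm2 u) ->
  norm2 x <= b.
Proof.
move=> b0 H; rewrite leNgt; apply/negP => bx.
have cf : continuous (fun u : 'rV[R]_d => dotp x u - b * norm2 u).
  move=> u; apply: (@cvgB _ _ _ (nbhs u)); first exact: dotp_continuous.
  by apply: (@cvgM _ _ (nbhs u)); [exact: cvg_cst|exact: norm2_continuous].
have [q] : exists q : 'rV[rat]_d, ((fun u => dotp x u - b * norm2 u) @^-1`
     [set t | 0 < t]) (map_mx ratr q).
  apply: dense_rat_row.
    by apply: open_comp; [by move=> u _; exact: cf|exact: open_gt].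
  exists x => /=; rewrite -sqr_norm2 expr2 -mulrBl.
  by apply: mulr_gt0; rewrite ?subr_gt0// (le_lt_trans b0).
by rewrite /= subr_gt0 ltNge dotpC; apply/negP; rewrite negbK; exact: H.
Qed.

Lemma measurable_coord (dd : measure_display) (T : measurableType dd)
    (G : set (set T)) (f : T -> 'rV[R]_d) j :
  Gmeasurable G f ->
  measurable_fun [set: g_sigma_algebraType G] (fun w => f w ord0 j).
Proof.
move=> mf; apply: (measurability _ (RGenOpens.measurableE R)).
move=> _ [_ [a [b ->] <-]]; rewrite setTI; apply: sub_sigma_algebra.
apply: (mf ((fun v : 'rV[R]_d => v ord0 j) @^-1` `]a, b[)).
apply: sub_sigma_algebra; apply: open_comp; last exact: interval_open.
by move=> v _; exact: coord_continuous.
Qed.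

Lemma measurable_dotp (dd : measure_display) (T : measurableType dd)
    (f g : T -> 'rV[R]_d) :
  (forall j, measurable_fun setT (fun w => f w ord0 j)) ->
  (forall j, measurable_fun setT (fun w => g w ord0 j)) ->
  measurable_fun setT (fun w => dotp (f w) (g w)).
Proof. by move=> mf mg; apply: measurable_sum => j; exact: measurable_funM. Qed.

Lemma measurable_norm2 (dd : measure_display) (T : measurableType dd)
    (f : T -> 'rV[R]_d) :
  (forall j, measurable_fun setT (fun w => f w ord0 j)) ->
  measurable_fun setT (fun w => norm2 (f w)).
Proof.
move=> mf; apply: measurableT_comp; last exact: measurable_dotp.
by apply: continuous_measurable_fun; exact: sqrt_continuous.
Qed.

End euclidean.

(** * Functions orthogonal to a sub-sigma-algebra, and norms of martingales *)

(** Stated on the alias of T that carries G as sigma-algebra, so that the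
    closure properties of measurable functions apply to G as they stand. *)
Definition Gmeasurable_fun (dd : measure_display) (T : measurableType dd)
    (R : realType) (G : set (set T)) (f : T -> R) : Prop :=
  measurable_fun [set: g_sigma_algebraType G] f.

Section orthogonality.
Context {R : realType} {dd : measure_display} {T : measurableType dd}.
Variable P : probability T R.

Lemma Gmeasurable_fun_sub (G : set (set T)) (f : T -> R) :
  sigma_algebra setT G -> G `<=` @measurable dd T -> Gmeasurable_fun G f ->
  measurable_fun [set: T] f.
Proof.
by move=> sG GT mf _ Y mY; apply: GT; rewrite -(sigma_algebra_id sG); exact: mf.
Qed.

Lemma Gmeasurable_fun_mono (G G' : set (set T)) (f : T -> R) :
  G `<=` G' -> Gmeasurable_fun G f -> Gmeasurable_fun G' f.
Proof. by move=> GG' mf _ Y mY; apply: (sub_sigma_algebra2 GG'); exact: mf. Qed.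

Lemma bounded_integrable (f : T -> R) (M : R) :
  measurable_fun setT f -> (forall w, `|f w| <= M) ->
  P.-integrable setT (EFin \o f).
Proof.
move=> mf fM; apply: measurable_bounded_integrable => //.
  by rewrite (le_lt_trans (probability_le1 P measurableT)) ?ltry.
exists M; split=> [|x Mx w _]; first exact: num_real.
exact: le_trans (fM w) (ltW Mx).
Qed.

Section orth.
Variables (G : set (set T)) (X : T -> R) (M : R).
Hypotheses (sG : sigma_algebra setT G) (GT : G `<=` @measurable dd T).
Hypotheses (mX : measurable_fun setT X) (XM : forall w, `|X w| <= M).
Hypothesis X0 : forall A, G A -> \int[P]_(w in A) X w = 0.

Let mul_int (g : T -> R) K : Gmeasurable_fun G g -> (forall w, `|g w| <= K) ->
  P.-integrable setT (EFin \o (fun w => g w * X w)).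
Proof.
move=> mg gK; apply: (@bounded_integrable _ (K * M)).
  by apply: measurable_funM => //; exact: Gmeasurable_fun_sub mg.
by move=> w; rewrite normrM ler_pM.
Qed.

(** For g with values in [0, 1], let A be the event g >= 1/2.  Then
    2 g - 1_A again has values in [0, 1], and as the integral of X over A is
    zero, passing to it doubles the integral of g X. *)
Let orth_halving n (g : T -> R) : Gmeasurable_fun G g ->
  (forall w, 0 <= g w <= 1) ->
  `|\int[P]_w (g w * X w)| <= 2 ^- n * M.
Proof.
elim: n g => [|n IH] g mg g01.
  have g1 w : `|g w| <= 1 by have /andP[g0 g1] := g01 w; rewrite ger0_norm.
  rewrite expr0 invr1 mul1r.
  apply: le_trans (le_normr_Rintegral _ (mul_int mg g1)) _ => //.
  rewrite -[leRHS]mulr1 -[1]/(fine 1%E) -(@probability_setT _ _ _ P).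
  rewrite -Rintegral_cst//.
  apply: le_Rintegral => //.
  - by have := mul_int mg g1 => /integrable_norm.
  - by apply: (@bounded_integrable _ `|M|).
  - move=> w _; rewrite normrM -[leRHS]mul1r.
    by rewrite ler_pM.
pose A := [set w | 1 / 2 <= g w].
have GA : G A.
  rewrite -(sigma_algebra_id sG).
  have := mg measurableT `[1 / 2, +oo[%classic (measurable_itv _).
  rewrite setTI; congr (<<s _ >> _).
  by apply/seteqP; split=> w; rewrite /A /= in_itv/= andbT.
pose g' w := 2 * g w - \1_A w.
have mA : Gmeasurable_fun G (\1_A : T -> R).
  by apply: measurable_indic; rewrite /measurable/= sigma_algebra_id.
have mg' : Gmeasurable_fun G g'.
  by apply: measurable_funB => //; apply: measurable_funM.
have g'01 w : 0 <= g' w <= 1.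
  have /andP[g0 g1] := g01 w; rewrite /g' indicE.
  have [/set_mem|/negP] := boolP (w \in A); rewrite /A /= => h; first lra.
  have : ~ 1 / 2 <= g w by move=> k; apply: h; exact/mem_set.
  by move/negP; rewrite -ltNge => ?; lra.
have g1 w : `|g w| <= 1 by have /andP[g0 g1] := g01 w; rewrite ger0_norm.
have i1 w : `|\1_A w : R| <= 1.
  by rewrite indicE; case: (_ \in _); rewrite ?normr1 ?normr0.
have -> : \int[P]_w (g w * X w) = 2^-1 * \int[P]_w (g' w * X w).
  have -> : \int[P]_w (g' w * X w) =
      \int[P]_w (2 * (g w * X w) - \1_A w * X w).
    by apply: eq_Rintegral => w _; rewrite /g'; ring.
  rewrite RintegralB//; last 2 first.
  - by have := integrableZl _ 2 (mul_int mg g1); apply.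
  - exact: mul_int mA i1.
  rewrite RintegralZl//; last exact: mul_int mg g1.
  have -> : \int[P]_w (\1_A w * X w) = 0.
    rewrite -(X0 GA) [RHS]Rintegral_mkcond; apply: eq_Rintegral => w _.
    by rewrite patchE indicE; case: (_ \in _); rewrite ?mul1r ?mul0r.
  by field.
rewrite normrM gtr0_norm ?invr_gt0// exprS invfM -mulrA.
by rewrite ler_pM2l ?invr_gt0// IH.
Qed.

(** The defining property of a conditional expectation is stated on events;
    this extends it to bounded functions, an affine change of variable
    reducing to values in [0, 1]. *)
Lemma Rintegral_orthogonal (g : T -> R) (K : R) : Gmeasurable_fun G g ->
  (forall w, `|g w| <= K) -> \int[P]_w (g w * X w) = 0.
Proof.
move=> mg gK.
have step (h : T -> R) : Gmeasurable_fun G h -> (forall w, 0 <= h w <= 1) ->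
    \int[P]_w (h w * X w) = 0.
  move=> mh h01; apply/eqP; rewrite -normr_le0.
  have : (fun n => 2 ^- n * M) @ \oo --> (0 : R).
    rewrite -[X in _ --> X](mul0r M); apply: cvgM; last exact: cvg_cst.
    under eq_fun do rewrite -exprVn; apply: cvg_expr.
    by rewrite gtr0_norm ?invr_gt0// invf_lt1// ltr1n.
  move=> c; apply: (ler_cvg_to (cvg_cst _) c).
  by apply: nearW => n; exact: orth_halving.
pose K' := `|K| + 1.
have K'0 : 0 < K' by rewrite ltr_wpDl.
pose h w := (g w / K' + 1) / 2.
have mh : Gmeasurable_fun G h.
  apply: measurable_funM => //; apply: measurable_funD => //.
  exact: measurable_funM.
have gK' w : `|g w / K'| <= 1.
  rewrite normrM normfV (gtr0_norm K'0) ler_pdivrMr// mul1r.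
  by rewrite (le_trans (gK w))// /K' (le_trans (ler_norm _))// lerDl.
have h01 w : 0 <= h w <= 1.
  by have := gK' w; rewrite ler_norml /h => /andP[]; lra.
have h1 w : `|h w| <= 1 by have /andP[? ?] := h01 w; rewrite ger0_norm.
have iX : P.-integrable setT (EFin \o X) by exact: bounded_integrable XM.
have GTT : G setT by case: sG => G0 GC _; rewrite -(setD0 setT); exact: GC.
have -> : \int[P]_w (g w * X w) = \int[P]_w (2 * K' * (h w * X w) - K' * X w).
  apply: eq_Rintegral => w _; rewrite /h; field; lra.
rewrite RintegralB//; last 2 first.
- by have := integrableZl _ (2 * K') (mul_int mh h1); apply.
- by have := integrableZl _ K' iX; apply.
rewrite !RintegralZl//; last exact: mul_int mh h1.
by rewrite step// X0// !mulr0 subrr.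
Qed.

End orth.

Section pinelis.
Context {d : nat}.
Variables (F : nat -> set (set T)) (Z : nat -> T -> 'rV[R]_d).
Hypothesis hF : filtration F.
Hypothesis mZ : forall t j, Gmeasurable_fun (F t.+1) (fun w => Z t.+1 w ord0 j).
Hypothesis Z0 : forall t A j, F t A -> \int[P]_(w in A) Z t.+1 w ord0 j = 0.

Let S n w := \sum_(1 <= t < n.+1) Z t w.

Let SS n w : S n.+1 w = S n w + Z n.+1 w.
Proof. by rewrite /S big_nat_recr. Qed.

Let S0 w : S 0 w = 0. Proof. by rewrite /S big_nil. Qed.

Let mS n j : Gmeasurable_fun (F n) (fun w => S n w ord0 j).
Proof.
elim: n => [|n IH].
  under [X in Gmeasurable_fun _ X]eq_fun do rewrite S0 mxE.
  exact: measurable_cst.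
under [X in Gmeasurable_fun _ X]eq_fun do rewrite SS mxE.
apply: measurable_funD; last exact: mZ.
by apply: Gmeasurable_fun_mono IH; case: hF => _ [_]; apply.
Qed.

Let mT n (f : T -> R) : Gmeasurable_fun (F n) f -> measurable_fun setT f.
Proof. by apply: Gmeasurable_fun_sub; case: hF => // _ []. Qed.

Let mnS n : Gmeasurable_fun (F n) (fun w => norm2 (S n w)).
Proof.
exact: (@measurable_norm2 R d _ (g_sigma_algebraType (F n)) (S n) (@mS n)).
Qed.

Section bounded.
Variable c : R.
Hypotheses (c0 : 0 < c) (Zc : forall t w, norm2 (Z t.+1 w) <= c).

Let S_le n w : norm2 (S n w) <= n%:R * c.
Proof.
elim: n => [|n IH]; first by rewrite S0 norm20 mul0r.
rewrite SS (le_trans (norm2_triangle _ _))// -natr1 mulrDl mul1r.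
by apply: lerD; [exact: IH|exact: Zc].
Qed.

Let mcosh n : Gmeasurable_fun (F n) (fun w => coshR (norm2 (S n w))).
Proof. exact: (measurableT_comp (@measurable_coshR R) (@mnS n)). Qed.

Let icosh n : P.-integrable setT (EFin \o (fun w => coshR (norm2 (S n w)))).
Proof.
apply: (@bounded_integrable _ (coshR (n%:R * c))); first exact: mT (@mcosh n).
move=> w; rewrite gtr0_norm ?coshR_gt0//.
exact: coshR_mono (norm2_ge0 _) (S_le n w).
Qed.

Lemma integrable_coshR_sum n : P.-integrable setT
  (EFin \o (fun w => coshR (norm2 (\sum_(1 <= t < n.+1) Z t w)))).
Proof. exact: icosh. Qed.

(** In coshR_norm2D the coefficient of the linear term depends on the past
    only and is bounded, because |sinh a| <= cosh a; the term therefore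
    integrates to zero and each step multiplies the bound by cosh c. *)
Lemma expectation_coshR_le n :
  \int[P]_w coshR (norm2 (\sum_(1 <= t < n.+1) Z t w)) <= coshR c ^+ n.
Proof.
rewrite -[leLHS]/(\int[P]_w coshR (norm2 (S n w))); elim: n => [|n IH].
  under eq_Rintegral do rewrite S0 norm20 coshR0.
  rewrite expr0 -[leRHS]mulr1 -[X in _ * X]/(fine 1%E).
  by rewrite -(@probability_setT _ _ _ P) -Rintegral_cst.
pose h w j :=
  sinhR (norm2 (S n w)) / norm2 (S n w) * (sinhR c / c) * S n w ord0 j.
pose K := coshR (n%:R * c) * `|sinhR c / c|.
have mh j : Gmeasurable_fun (F n) (h ^~ j).
  apply: measurable_funM; last exact: mS.
  apply: measurable_funM => //; apply: measurable_funM.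
    exact: (measurableT_comp (@measurable_sinhR R) (@mnS n)).
  (* Inversion is measurable as the power with exponent -1. *)
  under eq_fun do rewrite -powR_inv1 ?norm2_ge0//.
  exact: (measurableT_comp (measurable_powR _) (@mnS n)).
have hK w j : `|h w j| <= K.
  rewrite /h mulrAC normrM ler_wpM2r//.
  set s := S n w.
  have [/norm2_eq0 s0|s0] := eqVneq (norm2 s) 0.
    by rewrite s0 mxE mulr0 normr0 ltW// coshR_gt0.
  have sp : 0 < norm2 s by rewrite lt_neqAle eq_sym s0 norm2_ge0.
  rewrite mulrAC -mulrA normrM.
  apply: (@le_trans _ _ (coshR (norm2 s) * 1)); last first.
    by rewrite mulr1; exact: coshR_mono (norm2_ge0 _) (S_le n w).
  rewrite ler_pM// ?norm_sinhR_le// normrM normfV (gtr0_norm sp).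
  by rewrite ler_pdivrMr// mul1r coord_le_norm2.
have ihZ j : P.-integrable setT (EFin \o (fun w => h w j * Z n.+1 w ord0 j)).
  apply: (@bounded_integrable _ (K * c)).
    by apply: measurable_funM; [exact: mT (mh j)|exact: mT (@mZ n j)].
  by move=> w; rewrite normrM ler_pM// (le_trans (coord_le_norm2 _ _)).
have hZ0 j : \int[P]_w (h w j * Z n.+1 w ord0 j) = 0.
  case: (hF) => sF [FT _].
  have mZT := mT (@mZ n j).
  apply: (@Rintegral_orthogonal (F n) _ c (sF n) (FT n) mZT _ _ _ K) => //.
    by move=> w; rewrite (le_trans (coord_le_norm2 _ _)).
  by move=> A FA; exact: Z0.
have icc : P.-integrable setT
    (EFin \o (fun w => coshR c * coshR (norm2 (S n w)))).
  by have := integrableZl measurableT (coshR c) (icosh n).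
have isum : P.-integrable setT
    (EFin \o (fun w => \sum_(j < d) h w j * Z n.+1 w ord0 j)).
  have := integrable_sum measurableT (index_enum _)
    (fun j (_ : xpredT j) => ihZ j).
  by apply: eq_integrable => // w _ /=; rewrite sumEFin.
apply: (@le_trans _ _ (\int[P]_w (coshR c * coshR (norm2 (S n w))
    + \sum_(j < d) h w j * Z n.+1 w ord0 j))).
  apply: le_Rintegral => //.
    by have := integrableD measurableT icc isum.
  move=> w _; rewrite SS (le_trans (coshR_norm2D _ c0 (Zc n w)))//.
  rewrite (mulrC (coshR c)) lerD2l /dotp mulr_sumr.
  by apply: ler_sum => j _; rewrite /h !mulrA.
rewrite RintegralD//.
rewrite RintegralZl ?icosh//.
have -> : \int[P]_w (\sum_(j < d) h w j * Z n.+1 w ord0 j) = 0.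
  rewrite /Rintegral; under eq_integral do rewrite -sumEFin.
  rewrite integral_sum// big1// => j _; have := hZ0 j.
  rewrite /Rintegral => E; rewrite -[LHS]fineK ?E//.
  exact: integrable_fin_num (ihZ j).
by rewrite addr0 exprS ler_wpM2l// ltW// coshR_gt0.
Qed.

End bounded.
End pinelis.
End orthogonality.

(** * A dimension-free tail bound for bounded martingale differences *)

Section tail.
Context {R : realType} {dd : measure_display} {T : measurableType dd}.
Variable P : probability T R.
Context {d : nat}.

Lemma measurable_coord_sum (Z : nat -> T -> 'rV[R]_d) n j :
  (forall k, measurable_fun setT (fun w => Z k.+1 w ord0 j)) ->
  measurable_fun setT (fun w => (\sum_(1 <= k < n.+1) Z k w) ord0 j).
Proof.
move=> mZ; under eq_fun do rewrite summxE big_add1 /=.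
exact: measurable_sum.
Qed.

Lemma Rintegral_indic (A : set T) : measurable A ->
  \int[P]_w (\1_A w) = fine (P A).
Proof. by move=> mA; rewrite /Rintegral integral_indic// setIT. Qed.

(** The Markov inequality for cosh |lam S_n|, with
    cosh (lam t) >= exp (lam t) / 2.  The factor lam = t / (n c^2) minimizes
    the exponent n (lam c)^2 / 2 - lam t. *)
Lemma norm2_tail (F : nat -> set (set T)) (Z : nat -> T -> 'rV[R]_d) (c : R)
    (n : nat) (t : R) :
  filtration F ->
  (forall k j, Gmeasurable_fun (F k.+1) (fun w => Z k.+1 w ord0 j)) ->
  (forall k A j, F k A -> \int[P]_(w in A) Z k.+1 w ord0 j = 0) ->
  0 < c -> (forall k w, norm2 (Z k.+1 w) <= c) -> (0 < n)%N -> 0 <= t ->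
  (P [set w | (t <= norm2 (\sum_(1 <= k < n.+1) Z k w))%R]
     <= (2 * expR (- (t ^+ 2 / (2 * n%:R * c ^+ 2))))%:E)%E.
Proof.
move=> hF mZ Z0 c0 Zc n0 t_ge0.
have [sF [FT _]] := hF.
have mZT k j : measurable_fun setT (fun w => Z k.+1 w ord0 j).
  exact: Gmeasurable_fun_sub (mZ k j).
set A := [set w | _].
have mA : measurable A.
  apply: measurable_le_set => //; apply: measurable_norm2 => j.
  exact: measurable_coord_sum.
move: t_ge0; rewrite le_eqVlt => /predU1P[t0|t0].
  rewrite -t0 expr0n mul0r oppr0 expR0 mulr1.
  apply: (@le_trans _ _ 1%E); last by rewrite lee_fin ler1n.
  exact: probability_le1.
have nR : 0 < n%:R :> R by rewrite ltr0n.
pose lam := t / (n%:R * c ^+ 2).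
have lam0 : 0 < lam by rewrite divr_gt0// mulr_gt0// exprn_gt0.
pose Z' k w := lam *: Z k w.
have mZ' k j : Gmeasurable_fun (F k.+1) (fun w => Z' k.+1 w ord0 j).
  under [X in Gmeasurable_fun _ X]eq_fun do rewrite mxE.
  by apply: measurable_funM => //; exact: mZ.
have Z0' k B j : F k B -> \int[P]_(w in B) Z' k.+1 w ord0 j = 0.
  move=> FB; under eq_Rintegral do rewrite mxE.
  have mB : measurable B := FT k _ FB.
  rewrite RintegralZl// ?Z0 ?mulr0//.
  apply: (@integrableS _ _ _ _ setT) => //.
  apply: (@bounded_integrable _ _ _ _ _ c) => // w.
  exact: le_trans (coord_le_norm2 _ _) (Zc _ _).
have lc0 : 0 < lam * c by rewrite mulr_gt0.
have Zc' k w : norm2 (Z' k.+1 w) <= lam * c.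
  by rewrite norm2Z gtr0_norm// ler_pM2l.
have E := expectation_coshR_le hF mZ' Z0' lc0 Zc' n.
have I := integrable_coshR_sum P hF mZ' Zc' n.
have fA : P A \is a fin_num by rewrite fin_num_measure.
have H : coshR (lam * t) * fine (P A) <= coshR (lam * c) ^+ n.
  apply: le_trans E; rewrite -Rintegral_indic// -RintegralZl//; last first.
    by apply: integrable_indic.
  apply: le_Rintegral => //.
    apply: (@bounded_integrable _ _ _ _ _ (coshR (lam * t))).
      by apply: measurable_funM => //; exact: measurable_indic.
    move=> w; rewrite normrM (gtr0_norm (coshR_gt0 _)) -[leRHS]mulr1.
    rewrite ler_wpM2l ?(ltW (coshR_gt0 _))// indicE.
    by case: (_ \in _); rewrite ?normr1 ?normr0.
  move=> w _; rewrite indicE.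
  have [/set_mem wA|_] := boolP (w \in A); last first.
    by rewrite mulr0 ltW// coshR_gt0.
  rewrite mulr1 /Z' -scaler_sumr norm2Z gtr0_norm//.
  apply: coshR_mono; first by rewrite mulr_ge0// ltW.
  by rewrite ler_pM2l.
rewrite -(fineK fA) lee_fin.
have fA0 : 0 <= fine (P A) by rewrite fine_ge0.
have H2 : expR (lam * t) / 2 * fine (P A) <= expR ((lam * c) ^+ 2 / 2 * n%:R).
  apply: le_trans (_ : coshR (lam * t) * fine (P A) <= _).
    by rewrite ler_wpM2r// coshR_ge_halfexp.
  rewrite (le_trans H)// (mulrC (_ / 2)) expRM_natl lerXn2r ?nnegrE ?expR_ge0//.
    by rewrite ltW// coshR_gt0.
  exact: coshR_le_gauss.
have -> : - (t ^+ 2 / (2 * n%:R * c ^+ 2)) =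
    (lam * c) ^+ 2 / 2 * n%:R - lam * t.
  by rewrite /lam; field; rewrite !gt_eqF.
rewrite expRD expRN mulrA ler_pdivlMr ?expR_gt0//.
by move: H2; lra.
Qed.
End tail.

(** * Conditional expectations of variables with values in a bounded set *)

Section diameter.
Context {R : realType} {d : nat}.
Variable XX : set 'rV[R]_d.
Hypothesis bXX : bounded_set XX.

Lemma bounded_norm2 : exists M, forall x, XX x -> norm2 x <= M.
Proof.
have [M [_ HM]] := bXX.
exists (Num.sqrt (\sum_(j < d) (M + 1) ^+ 2)) => x Xx.
rewrite ler_wsqrtr// ler_sum// => j _; rewrite -expr2.
have H : `|x ord0 j| <= M + 1.
  apply: le_trans (HM (M + 1) _ _ Xx); last by rewrite ltrDl.
  rewrite [leRHS]mx_normrE.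
  exact: (le_bigmax _ (fun ij => `|x ij.1 ij.2|) (ord0, j)).
rewrite -[x ord0 j ^+ 2]real_normK ?num_real// lerXn2r ?nnegrE//.
exact: le_trans H.
Qed.

Lemma norm2_le_diam2 x y : XX x -> XX y -> norm2 (x - y) <= diam2 XX.
Proof.
move=> Xx Xy; have [M HM] := bounded_norm2.
apply: ub_le_sup; last by exists x => //; exists y.
exists (M + M) => _ [a Xa [b Xb <-]].
by rewrite (le_trans (norm2_triangle _ _))// norm2N lerD ?HM.
Qed.

Lemma open_norm2_gt (D : R) :
  open [set y | exists2 x, XX x & D < norm2 (x - y)].
Proof.
have -> : [set y | exists2 x, XX x & D < norm2 (x - y)] =
    \bigcup_(x in XX) [set y | D < norm2 (x - y)].
  by apply/seteqP; split=> y [x Xx xy]; exists x.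
apply: bigcup_open => x _.
rewrite -[X in open X]/((fun y => norm2 (x - y)) @^-1` [set t | D < t]).
apply: open_comp.
  move=> y _.
  apply: (@continuous_comp 'rV[R]_d 'rV[R]_d R (fun y => x - y) (@norm2 R d)).
    by apply: (@cvgB _ _ _ (nbhs y)); [exact: cvg_cst|exact: cvg_id].
  exact: norm2_continuous.
exact: open_gt.
Qed.

End diameter.

Section conditional_mean.
Context {R : realType} {dd : measure_display} {T : measurableType dd}.
Variable P : probability T R.
Context {d : nat}.
Variables (XX : set 'rV[R]_d) (G : set (set T)) (X Y : T -> 'rV[R]_d).
Hypothesis bXX : bounded_set XX.
Hypothesis X_in : forall w, XX (X w).
Hypothesis mX : forall j, measurable_fun setT (fun w => X w ord0 j).
Hypothesis GT : G `<=` @measurable dd T.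
Hypothesis hY : is_cond_exp P G X Y.

Let iX j : P.-integrable setT (EFin \o (fun w => X w ord0 j)).
Proof.
have [M HM] := bounded_norm2 bXX.
apply: (@bounded_integrable _ _ _ _ _ M) => // w.
exact: le_trans (coord_le_norm2 _ _) (HM _ (X_in w)).
Qed.

Lemma Gmeasurable_halfspace (u : 'rV[R]_d) c : G [set w | dotp u (Y w) < c].
Proof.
case: hY => mY _ _; apply: (mY [set y | dotp u y < c]).
apply: sub_sigma_algebra.
rewrite -[X in open X]/(dotp u @^-1` [set t | t < c]).
apply: open_comp; last exact: open_lt.
by move=> y _; exact: dotp_continuous.
Qed.

Let integral_dotp (u : 'rV[R]_d) (f : T -> 'rV[R]_d) B : measurable B ->
  (forall j, P.-integrable setT (EFin \o (fun w => f w ord0 j))) ->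
  P.-integrable B (EFin \o (fun w => dotp u (f w))) /\
  (\int[P]_(w in B) (dotp u (f w))%:E =
    \sum_(j < d) (u ord0 j)%:E * \int[P]_(w in B) (f w ord0 j)%:E)%E.
Proof.
move=> mB fi.
have fiB j : P.-integrable B (EFin \o (fun w => f w ord0 j)).
  exact: (@integrableS _ _ _ _ setT).
have ufi j : P.-integrable B (fun w => (u ord0 j)%:E * (f w ord0 j)%:E)%E.
  exact: integrableZl (fiB j).
split.
  have := integrable_sum mB (index_enum _) (fun j (_ : xpredT j) => ufi j).
  apply: eq_integrable => // w _ /=; rewrite /dotp -sumEFin.
  by apply: eq_bigr => j _; rewrite EFinM.
transitivity (\int[P]_(w in B) \sum_(j < d) (u ord0 j)%:E * (f w ord0 j)%:E)%E.
  by apply: eq_integral => w _; rewrite /dotp -sumEFin.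
rewrite integral_sum//; apply: eq_bigr => j _.
exact: (integralZl mB (fiB j) (u ord0 j)).
Qed.

(** The integral of c - u.Y over the event u.Y < c equals that of c - u.X,
    which is nonpositive, although its integrand is positive there. *)
Lemma cond_exp_halfspace (u : 'rV[R]_d) c : (forall w, c <= dotp u (X w)) ->
  P [set w | dotp u (Y w) < c] = 0%E.
Proof.
move=> cX; set B := [set w | _].
have GB : G B by exact: Gmeasurable_halfspace.
have mB : measurable B by exact: GT.
case: hY => mY iY EY.
have [iuX EuX] := integral_dotp u mB iX.
have [iuY EuY] := integral_dotp u mB iY.
have ic : P.-integrable B (EFin \o cst c).
  exact: finite_measure_integrable_cst.
have E : (\int[P]_(w in B) `|(c - dotp u (Y w))%:E| = 0)%E.
  apply/eqP; rewrite eq_le integral_ge0 ?andbT//.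
  rewrite (_ : integral _ _ _ = \int[P]_(w in B) (c - dotp u (Y w))%:E)%E.
    rewrite integralB_EFin// EuY sube_le0.
    under eq_bigr do rewrite EY//.
    by rewrite -EuX; apply: le_integral => // w _; rewrite lee_fin.
  apply: eq_integral => w /set_mem Bw; rewrite gee0_abs// lee_fin subr_ge0.
  exact: ltW.
have mf : measurable_fun B (fun w => (c - dotp u (Y w))%:E).
  by apply/measurable_EFinP; apply: measurable_funB => //;
    exact/measurable_EFinP/(measurable_int P iuY).
have := (ae_eq_integral_abs P mB mf).1 E.
move=> [N [mN PN sN]]; apply/eqP; rewrite -measure_le0 -PN.
apply: le_measure; rewrite ?inE// => w Bw; apply: sN => /= /(_ Bw)/eqP.
by rewrite eqe gt_eqF// subr_gt0.
Qed.

Lemma Gmeasurable_far (D : R) :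
  G [set w | exists2 x, XX x & D < norm2 (x - Y w)].
Proof.
case: hY => mY _ _.
apply: (mY [set y | exists2 x, XX x & D < norm2 (x - y)]).
by apply: sub_sigma_algebra; exact: open_norm2_gt.
Qed.

(** For each rational u, almost surely u.Y is at least the infimum of the
    linear form u over XX, hence at least u.x - |u| diam2 XX for all x in XX
    simultaneously;
    norm2_le_dual turns these countably many constraints into
    |x - Y| <= diam2 XX. *)
Lemma cond_exp_near :
  P [set w | exists2 x, XX x & diam2 XX < norm2 (x - Y w)] = 0%E.
Proof.
set B := [set w | _]; have mB : measurable B by exact/GT/Gmeasurable_far.
pose u (q : 'rV[rat]_d) : 'rV[R]_d := map_mx ratr q.
pose c q := inf [set dotp (u q) x | x in XX].
have lbc q : has_lbound [set dotp (u q) x | x in XX].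
  have [M HM] := bounded_norm2 bXX.
  exists (- (norm2 (u q) * M)) => _ [x Xx <-].
  rewrite lerNl (le_trans (ler_norm _))// normrN.
  by rewrite (le_trans (dotp_norm2 _ _))// ler_wpM2l ?norm2_ge0// HM.
pose H q := [set w | dotp (u q) (Y w) < c q].
have PH q : P.-negligible (H q).
  exists (H q); split=> //; first exact/GT/Gmeasurable_halfspace.
  by apply: cond_exp_halfspace => w; apply: ge_inf => //; exists (X w).
apply: measure_negligible => //.
(* The rational directions are enumerated through their natural number codes. *)
apply: (@negligibleS _ _ _ _ (\bigcup_k
    (if @unpickle 'rV[rat]_d k is Some q then H q else set0))); last first.
  apply: negligible_bigcup => k; case: unpickle => //.
  exact: negligible_set0.
move=> w [x Xx xw]; apply: contrapT => nH.
move: xw; rewrite ltNge => /negP; apply.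
apply: norm2_le_dual.
  by apply: le_trans (norm2_le_diam2 bXX Xx Xx); exact: norm2_ge0.
move=> q; rewrite -/(u q) /= dotpBr.
have cq : c q <= dotp (u q) (Y w).
  rewrite leNgt; apply/negP => h; apply: nH; exists (pickle q) => //.
  by rewrite pickleK.
have : dotp (u q) x - diam2 XX * norm2 (u q) <= c q.
  apply: lb_le_inf; first by exists (dotp (u q) x); exists x.
  move=> _ [y Xy <-]; rewrite lerBlDr -lerBlDl -dotpBr.
  rewrite (le_trans (ler_norm _))// (le_trans (dotp_norm2 _ _))// mulrC.
  by rewrite ler_wpM2r ?norm2_ge0// norm2_le_diam2.
lra.
Qed.

End conditional_mean.

(** * Deviation of the empirical mean from the mean of conditional means *)

Section mean.
Context {R : realType} {dd : measure_display} {T : measurableType dd}.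
Variable P : probability T R.
Context {d : nat}.
Variables (F : nat -> set (set T)) (XX : set 'rV[R]_d).
Variables (X EX : nat -> T -> 'rV[R]_d).
Hypothesis hF : filtration F.
Hypothesis bXX : bounded_set XX.
Hypothesis X_in : forall t w, XX (X t w).
Hypothesis X_adapted : forall t, Gmeasurable (F t) (X t).
Hypothesis hEX : forall t, is_cond_exp P (F t) (X t.+1) (EX t.+1).

Lemma sigma_filtration t : sigma_algebra setT (F t).
Proof. by case: hF. Qed.

Lemma filtration_measurable t : F t `<=` @measurable dd T.
Proof. by case: hF => _ []. Qed.

Lemma measurable_adapted_coord t (Y : T -> 'rV[R]_d) j : Gmeasurable (F t) Y ->
  measurable_fun setT (fun w => Y w ord0 j).
Proof.
move=> mY; apply: (@Gmeasurable_fun_sub _ _ _ (F t)).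
  exact: sigma_filtration.
  exact: filtration_measurable.
exact: measurable_coord.
Qed.

Let mX t j : measurable_fun setT (fun w => X t w ord0 j).
Proof. exact: measurable_adapted_coord (X_adapted t). Qed.

Let mEX t j : measurable_fun setT (fun w => EX t.+1 w ord0 j).
Proof. by case: (hEX t) => + _ _; exact: measurable_adapted_coord. Qed.

Let far t := [set w | exists2 x, XX x & diam2 XX < norm2 (x - EX t w)].

Let Ffar t : F t (far t.+1).
Proof. exact: (Gmeasurable_far _ (hEX t)). Qed.

Let Pfar t : P (far t.+1) = 0%E.
Proof.
apply: (cond_exp_near bXX (X_in t.+1) (mX t.+1) _ (hEX t)).
exact: filtration_measurable.
Qed.

(** The bounded version of the martingale difference X_t - E[X_t | F_(t-1)]. *)
Let Z t w := if w \in far t then 0 else X t w - EX t w.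

Let ZE t w j : Z t w ord0 j =
  ((fun w => X t w ord0 j - EX t w ord0 j) \_ (~` far t)) w.
Proof.
rewrite /Z patchE in_setC; case: (w \in far t); first by rewrite mxE.
by rewrite !mxE.
Qed.

Let mZ t j : Gmeasurable_fun (F t.+1) (fun w => Z t.+1 w ord0 j).
Proof.
under [X in Gmeasurable_fun _ X]eq_fun do rewrite ZE.
have FS : F t `<=` F t.+1 by case: hF => _ [].
have mfc : measurable (~` far t.+1 : set (g_sigma_algebraType (F t.+1))).
  rewrite /measurable/= sigma_algebra_id; last exact: sigma_filtration.
  apply: FS; case: (sigma_filtration t) => _ FC _.
  by have := FC _ (Ffar t); rewrite setTD.
apply: ((measurable_restrictT _ mfc).1).
apply: (@measurable_funS _ _ (g_sigma_algebraType (F t.+1)) _ setT) => //.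
apply: measurable_funB; first exact: measurable_coord.
apply: (Gmeasurable_fun_mono FS).
by case: (hEX t) => + _ _; exact: measurable_coord.
Qed.

Let Z0 t B j : F t B -> \int[P]_(w in B) Z t.+1 w ord0 j = 0.
Proof.
move=> FB; under eq_Rintegral do rewrite ZE.
rewrite -Rintegral_mkcondr.
have FC : F t (B `&` ~` far t.+1).
  rewrite -(sigma_algebra_id (sigma_filtration t)).
  have mB : measurable (B : set (g_sigma_algebraType (F t))).
    by rewrite /measurable/= sigma_algebra_id//; exact: sigma_filtration.
  have mf : measurable (far t.+1 : set (g_sigma_algebraType (F t))).
    rewrite /measurable/= sigma_algebra_id; first exact: Ffar.
    exact: sigma_filtration.
  exact: measurableI mB (measurableC mf).
have mC := filtration_measurable FC.
case: (hEX t) => _ iE EE.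
rewrite RintegralB//; last 2 first.
- apply: (@integrableS _ _ _ P setT) => //.
  have [M HM] := bounded_norm2 bXX.
  apply: (@bounded_integrable _ _ _ _ _ M) => // w.
  exact: le_trans (coord_le_norm2 _ _) (HM _ (X_in _ w)).
- by apply: (@integrableS _ _ _ P setT) => //; exact: iE.
by rewrite /Rintegral (EE _ FC j) subrr.
Qed.

Hypothesis D0 : 0 < diam2 XX.

Let Zle t w : norm2 (Z t.+1 w) <= diam2 XX.
Proof.
rewrite /Z; have [_|nf] := boolP (w \in far t.+1); first by rewrite norm20 ltW.
rewrite leNgt; apply/negP => h; move: nf => /negP; apply.
by apply/mem_set; exists (X t.+1 w).
Qed.

(** The radius is chosen so that the Gaussian tail at the corresponding
    t = 2 D sqrt (n ln n) is exactly 2 exp (- 2 ln n). *)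
Lemma mean_tail n : (0 < n)%N ->
  (P [set w | (2 * diam2 XX * Num.sqrt (ln n%:R / n%:R) <
     norm2 (n%:R^-1 *: \sum_(1 <= t < n.+1) X t w - mean_cond EX n w))%R]
   <= (2 / n%:R ^+ 2)%:E)%E.
Proof.
move=> n0; have nR : 0 < n%:R :> R by rewrite ltr0n.
set D := diam2 XX; set E := [set w | _]; have Dp : 0 < D by [].
pose t0 := n%:R * (2 * D * Num.sqrt (ln n%:R / n%:R)).
have lnn : 0 <= ln n%:R :> R by rewrite ln_ge0// ler1n.
have t00 : 0 <= t0 by rewrite !mulr_ge0 ?sqrtr_ge0// ltW.
pose N := \bigcup_t far t.+1.
have mfar t : measurable (far t.+1) by exact/filtration_measurable/Ffar.
have mN : measurable N by exact: bigcupT_measurable.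
have PN : P N = 0%E.
  apply: measure_negligible => //; apply: negligible_bigcup => k.
  by exists (far k.+1); split => //; exact: Pfar.
pose A := [set w | t0 <= norm2 (\sum_(1 <= k < n.+1) Z k w)].
have mA : measurable A.
  have mZT k j : measurable_fun setT (fun w => Z k.+1 w ord0 j).
    apply: (@Gmeasurable_fun_sub _ _ _ (F k.+1)); first exact: sigma_filtration.
      exact: filtration_measurable.
    exact: mZ.
  apply: measurable_le_set => //; apply: measurable_norm2 => j.
  exact: measurable_coord_sum.
have mE : measurable E.
  apply: measurable_lt_set => //; apply: measurable_norm2 => j.
  under eq_fun do rewrite /mean_cond !mxE.
  apply: measurable_funB; apply: measurable_funM => //;
    exact: measurable_coord_sum.
have EAN : E `<=` A `|` N.
  move=> w Ew; have [Nw|nN] := pselect (N w); [by right|left].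
  rewrite /A /= (_ : \sum_(_ <= k < _) Z k w =
    \sum_(1 <= t < n.+1) X t w - \sum_(1 <= t < n.+1) EX t w); last first.
    rewrite -sumrB; apply: eq_big_nat => -[//|k] _; rewrite /Z.
    by rewrite memNset// => fk; apply: nN; exists k.
  move: Ew; rewrite /E /= /mean_cond -scalerBr norm2Z normfV gtr0_norm//.
  by rewrite ltr_pdivlMl// => /ltW.
apply: (@le_trans _ _ (P (A `|` N))).
  by rewrite le_measure ?inE//; exact: measurableU.
apply: (@le_trans _ _ (P A + P N)%E); first exact: measureU2.
rewrite PN adde0.
apply: (le_trans (norm2_tail hF mZ Z0 D0 Zle n0 t00)).
rewrite lee_fin ler_pM2l// (_ : t0 ^+ 2 / _ = 2%:R * ln n%:R); last first.
  rewrite /t0 !exprMn sqr_sqrtr; last by rewrite divr_ge0// ltW.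
  by rewrite -/D; field; rewrite !gt_eqF.
by rewrite expRN expRM_natl lnK ?posrE.
Qed.

End mean.

(** * Series, hitting times and lower limits *)

Section series.
Context {R : realType}.

(** Only the first term uses the bound by 1; it saves 1 on the total and
    leaves room for the telescoping bound by 3 - 2 / n of the partial
    sums. *)
Lemma sum_min_inv_sqr_le :
  (\sum_(1 <= n <oo) (Num.min 1 (2 / n%:R ^+ 2))%:E <= (pi ^+ 2 / 3 : R)%:E)%E.
Proof.
pose q n : R := Num.min 1 (2 / n%:R ^+ 2).
have q0 n : 0 <= q n by rewrite le_min ler01 divr_ge0// exprn_ge0.
have S n : (0 < n)%N -> \sum_(1 <= k < n.+1) q k <= 3 - 2 / n%:R.
  elim: n => // -[|n] IH _.
    rewrite big_nat1 divr1 (_ : 3 - 2 = 1); first by rewrite /q ge_min lexx.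
    by ring.
  rewrite big_nat_recr//=.
  apply: (@le_trans _ _ (3 - 2 / n.+1%:R + 2 / n.+2%:R ^+ 2)).
    by rewrite lerD ?IH// /q ge_min lexx orbT.
  have a0 : 0 < n.+1%:R :> R by rewrite ltr0n.
  rewrite -(natr1 n.+1); set a := n.+1%:R in a0 *.
  have a10 : 0 < a + 1 by rewrite addr_gt0.
  rewrite -subr_ge0 (_ : _ - _ = 2 / (a * (a + 1) ^+ 2)).
    by rewrite divr_ge0// mulr_ge0 ?exprn_ge0// ltW.
  by field; rewrite !gt_eqF.
apply: (@le_trans _ _ 3%:E); last first.
  rewrite lee_fin ler_pdivlMr// (_ : 3 * 3 = 3 ^+ 2 :> R); last by ring.
  by rewrite lerXn2r ?nnegrE ?pi_ge0// pi_ge3.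
apply: lime_le; first by apply: is_cvg_nneseries => n _ _; rewrite lee_fin.
apply: nearW => -[|[|n]].
- by rewrite big_nil.
- by rewrite big_nil.
- rewrite sumEFin lee_fin (le_trans (S n.+1 _))//.
  by rewrite gerBl divr_ge0.
Qed.

End series.

Section probability.
Context {R : realType} {dd : measure_display} {T : measurableType dd}.
Variable P : probability T R.

(** The integral of a nonnegative function is by definition a supremum over
    the simple functions below it, and this supremum is monotone. *)
Lemma le_integral_nonmeasurable (f g : T -> \bar R) :
  (forall w, 0 <= f w)%E -> (forall w, f w <= g w)%E ->
  (\int[P]_w f w <= \int[P]_w g w)%E.
Proof.
move=> f0 fg; have g0 w : (0 <= g w)%E by exact: le_trans (fg w).
rewrite !ge0_integralTE//; apply: ereal_sup_le => _ [h hf <-].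
by exists h => // w; exact: le_trans (hf w) (fg w).
Qed.

(** Either all the events E n with n >= N occur and the sum of their
    indicators is infinite, or the least n >= N at which E n fails is N plus
    the number of events that occurred before it. *)
Lemma integral_first_time_le (tau : T -> \bar R) (E : nat -> set T) (N : nat) :
  (forall n, measurable (E n)) -> (forall w, 0 <= tau w)%E ->
  (forall w n, (N <= n)%N -> ~ E n w -> tau w <= n%:R%:E)%E ->
  (\int[P]_w tau w <= N%:R%:E + \sum_(N <= n <oo) P (E n))%E.
Proof.
move=> mE tau0 H.
pose S w := (\sum_(0 <= n <oo) (\1_(E (n + N)%N) w)%:E : \bar R)%E.
have i0 n w : (0 <= (\1_(E (n + N)%N) w)%:E :> \bar R)%E by rewrite lee_fin.
have S0 w : (0 <= S w)%E by exact: nneseries_ge0.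
have Sge w k : (forall n, (n < k)%N -> E (n + N)%N w) -> (k%:R%:E <= S w)%E.
  move=> Ek; apply: le_trans (nneseries_lim_ge k (fun n _ _ => i0 n w)).
  rewrite (eq_big_nat _ _ (F2 := fun=> (1 : R)%:E)).
    by rewrite sumEFin sumr_const_nat subn0.
  by move=> n /= nk; rewrite indicE mem_set//; exact: Ek.
apply: (@le_trans _ _ (\int[P]_w (N%:R%:E + S w))%E).
  apply: le_integral_nonmeasurable => // w.
  have [allE|/existsNP[n0 nE]] := pselect (forall n, E (n + N)%N w).
    rewrite (_ : S w = +oo%E) ?addey ?leey//.
    apply/eqyP => A A0; apply: (@le_trans _ _ (Num.bound A)%:R%:E).
      by rewrite lee_fin ltW// archi_boundP// ltW.
    by apply: Sge => n _.
  have ex : exists n, `[< ~ E (n + N)%N w >] by exists n0; exact/asboolP.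
  have := ex_minnP ex => -[n /asboolP nEn nmin].
  apply: (le_trans (H w (n + N)%N (leq_addl _ _) nEn)).
  rewrite natrD EFinD addeC leeD2l// Sge// => k kn.
  apply: contrapT => nk; move: kn; rewrite ltnNge nmin//; exact/asboolP.
have mS : measurable_fun setT S.
  apply: ge0_emeasurable_sum => // n _.
  by apply/measurable_EFinP; exact: measurable_indic.
rewrite ge0_integralD//.
rewrite (integral_cst P measurableT) [X in (_ * X)%E](_ : _ = 1%E); last first.
  exact: probability_setT.
rewrite mule1 leeD2l//.
rewrite integral_nneseries//; last first.
  by move=> n; apply/measurable_EFinP; exact: measurable_indic.
rewrite -(nneseries_addn N)//.
by under eq_eseriesr do rewrite integral_indic// setIT.
Qed.

Lemma ae_limn_einf_ge1 (v : nat -> T -> R) (E : nat -> set T) :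
  (forall n, measurable (E n)) ->
  (\sum_(0 <= n <oo) P (E n) < +oo)%E ->
  (\forall n \near \oo, forall w, ~ E n w -> 1 <= v n w) ->
  {ae P, forall w, (1 <= limn_einf (fun n => (v n w)%:E))%E}.
Proof.
move=> mE sE vE; exists (lim_sup_set E); split.
- apply: bigcapT_measurable => n; apply: bigcup_measurable => k _; exact: mE.
- exact: lim_sup_set_cvg0.
- move=> w /= nlim; apply: contrapT => nE; apply: nlim.
  move/existsNP : nE => [n /not_implyP[_ nE]].
  rewrite limn_einf_lim; apply: lime_ge; first exact: is_cvg_einfs.
  have [m _ Hm] := vE.
  near=> k; apply: le_ereal_inf_tmp => _ [j /= kj <-]; rewrite lee_fin.
  apply: (Hm j) => /=.
    by apply: leq_trans kj; near: k; exact: nbhs_infty_ge.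
  move=> Ej; apply: nE; exists j => //=.
  by apply: leq_trans kj; near: k; exact: nbhs_infty_ge.
Unshelve. all: by end_near. Qed.

End probability.

(** * Wealth and regret *)

Section betting.
Context {R : realType} {T : Type} {d : nat}.
Variables (D : R) (X lam : nat -> T -> 'rV[R]_d).

Lemma ln_LHE l n w : ln (LH D X l n w) =
  dotp l (\sum_(1 <= t < n.+1) X t w) - n%:R * (norm2 l ^+ 2 * D ^+ 2 / 8).
Proof.
rewrite /LH -expR_sum expRK sumrB dotp_sumr; congr (_ - _).
by rewrite sumr_const_nat subn1 mulr_natl.
Qed.

Lemma ln_WHE n w : ln (WH D X lam n w) = \sum_(1 <= t < n.+1)
  (dotp (lam t w) (X t w) - norm2 (lam t w) ^+ 2 * D ^+ 2 / 8).
Proof. by rewrite /WH -expR_sum expRK. Qed.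

Lemma WH_gt0 n w : 0 < WH D X lam n w.
Proof. by rewrite /WH -expR_sum expR_gt0. Qed.

Lemma regretH_gtP (r : R) n w : (r%:E < regretH D X lam n w)%E <->
  exists l, r + ln (WH D X lam n w) < ln (LH D X l n w).
Proof.
rewrite /regretH lteBrDr// -EFinD; split.
  by move=> /ereal_sup_gt[_ [l _ <-]]; rewrite lte_fin => rl; exists l.
move=> [l rl]; apply/ereal_sup_gtP.
by exists (ln (LH D X l n w))%:E; [exists l|rewrite lte_fin].
Qed.

(** The quadratic l |-> ln (LH D X l n w) is evaluated at its maximizer
    l = 4 xbar / D^2. *)
Lemma ln_WH_ge (r m delta : R) (mu : 'rV[R]_d) n w : (0 < n)%N -> 0 < D ->
  (regretH D X lam n w <= r%:E)%E -> m <= norm2 mu ->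
  norm2 (n%:R^-1 *: \sum_(1 <= t < n.+1) X t w - mu) <= delta ->
  2 * n%:R * Num.max (m - delta) 0 ^+ 2 / D ^+ 2 - r <= ln (WH D X lam n w).
Proof.
move=> n0 D0 Rr mmu dmu; have nR : 0 < n%:R :> R by rewrite ltr0n.
set xbar := n%:R^-1 *: _ in dmu.
have Sx : \sum_(1 <= t < n.+1) X t w = n%:R *: xbar.
  by rewrite /xbar scalerA divff ?gt_eqF// scale1r.
have Hl l : ln (LH D X l n w) - r <= ln (WH D X lam n w).
  rewrite lerBlDl leNgt; apply/negP => h.
  move: Rr; rewrite leNgt => /negP; apply.
  by apply/regretH_gtP; exists l.
have key : 2 * n%:R * norm2 xbar ^+ 2 / D ^+ 2 - r <= ln (WH D X lam n w).
  apply: le_trans (Hl ((4 / D ^+ 2) *: xbar)); rewrite lerD2r ln_LHE Sx.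
  rewrite dotpZl dotpZr -sqr_norm2 (norm2Z (4 / _)) exprMn.
  rewrite real_normK ?num_real//.
  rewrite le_eqVlt; apply/orP; left; apply/eqP.
  by field; rewrite gt_eqF.
apply: le_trans key; rewrite lerD2r ler_pM2r ?invr_gt0 ?exprn_gt0//.
rewrite ler_pM2l ?mulr_gt0// lerXn2r ?nnegrE ?norm2_ge0 ?le_max ?lexx ?orbT//.
rewrite ge_max norm2_ge0 andbT lerBlDr (le_trans mmu)//.
have -> : mu = xbar + - (xbar - mu) by rewrite opprB addrC subrK.
by rewrite (le_trans (norm2_triangle _ _))// norm2N lerD2l.
Qed.

End betting.

Section betting_measurability.
Context {R : realType} {dd : measure_display} {T : measurableType dd} {d : nat}.
Variables (D : R) (X lam : nat -> T -> 'rV[R]_d).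
Hypothesis mX : forall t j, measurable_fun setT (fun w => X t.+1 w ord0 j).
Hypothesis mlam : forall t j, measurable_fun setT (fun w => lam t.+1 w ord0 j).

Lemma measurable_ln_WH n : measurable_fun setT (fun w => ln (WH D X lam n w)).
Proof.
under eq_fun do rewrite ln_WHE big_add1 /=.
apply: measurable_sum => t; apply: measurable_funB.
  exact: measurable_dotp.
apply: measurable_funM => //; apply: measurable_funM => //.
by apply: measurable_funX; exact: measurable_norm2.
Qed.

Lemma measurable_ln_LH l n : measurable_fun setT (fun w => ln (LH D X l n w)).
Proof.
under eq_fun do rewrite ln_LHE.
apply: measurable_funB => //; apply: measurable_dotp => // j.
exact: measurable_coord_sum.
Qed.

(** The log-wealth of a constant bet is continuous in the bet, so a bet that
    witnesses a large regret can be taken rational. *)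
Lemma measurable_regretH_gt (r : R) n :
  measurable [set w | (r%:E < regretH D X lam n w)%E].
Proof.
pose u (q : 'rV[rat]_d) : 'rV[R]_d := map_mx ratr q.
pose A l := [set w | r + ln (WH D X lam n w) < ln (LH D X l n w)].
have mA l : measurable (A l).
  apply: measurable_lt_set; last exact: measurable_ln_LH.
  by apply: measurable_funD => //; exact: measurable_ln_WH.
rewrite (_ : [set w | _] = \bigcup_k
    (if @unpickle 'rV[rat]_d k is Some q then A (u q) else set0)).
  by apply: bigcupT_measurable => k; case: unpickle.
apply/seteqP; split=> w /=.
  move=> /regretH_gtP[l rl].
  set c := r + ln (WH D X lam n w) in rl.
  set S := \sum_(1 <= t < n.+1) X t w.
  pose f l := dotp S l - n%:R * (norm2 l ^+ 2 * D ^+ 2 / 8).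
  have cf : continuous f.
    move=> v; apply: (@cvgB _ _ _ (nbhs v)); first exact: dotp_continuous.
    apply: (@cvgM _ _ (nbhs v)); first exact: cvg_cst.
    apply: (@cvgM _ _ (nbhs v)); last exact: cvg_cst.
    apply: (@cvgM _ _ (nbhs v)); last exact: cvg_cst.
    by apply: (@cvgM _ _ (nbhs v)); exact: norm2_continuous.
  have [q fq] : exists q, (f @^-1` [set t | c < t]) (u q).
    apply: dense_rat_row.
      by apply: open_comp; [move=> v _; exact: cf|exact: open_gt].
    by exists l; rewrite /= /f dotpC; move: rl; rewrite ln_LHE.
  exists (pickle q) => //; rewrite pickleK /A /= ln_LHE dotpC.
  exact: fq.
move=> [k _]; case: unpickle => // q Aq.
by apply/regretH_gtP; exists (u q).
Qed.

End betting_measurability.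

(** * Lower bounds on the log-wealth *)

Theorem theorem2p7 (R : realType) (dd : measure_display)
  (T : measurableType dd) (P : probability T R)
  (F : nat -> set (set T)) (hF : filtration F)
  (d : nat) (hd : (1 <= d)%N)
  (XX : set 'rV[R]_d) (hXX : bounded_set XX)
  (X : nat -> T -> 'rV[R]_d)
  (X_in : forall t w, XX (X t w))
  (X_adapted : forall t, Gmeasurable (F t) (X t))
  (D : R) (hD : D = diam2 XX)
  (EX : nat -> T -> 'rV[R]_d)
  (hEX : forall t, is_cond_exp P (F t) (X t.+1) (EX t.+1))
  (lam : nat -> T -> 'rV[R]_d)
  (lam_predictable : forall n, Gmeasurable (F n) (lam n.+1))
  (r : nat -> R) (r_ge0 : forall n, (1 <= n)%N -> 0 <= r n)
  (rho : \bar R)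
  (rhoE : (rho = \sum_(1 <= n <oo)
     P [set w | (r n)%:E < regretH D X lam n w])%E)
  (rho_fin : (rho < +oo)%E)
  (m : nat -> R) (m_ge0 : forall n, (1 <= n)%N -> 0 <= m n)
  (varrho1 : \bar R)
  (varrho1E : (varrho1 = \sum_(1 <= n <oo)
     P [set w | (norm2 (mean_cond EX n w) < m n)%R])%E)
  (varrho1_fin : (varrho1 < +oo)%E) :
  [/\ (\sum_(1 <= n <oo) P [set w | (ln (WH D X lam n w) < uH D r m n)%R]
         <= rho + varrho1 + (pi ^+ 2 / 3)%:E)%E,
      (rho + varrho1 + (pi ^+ 2 / 3)%:E < +oo)%E,
      (\forall n \near \oo, 0 < uH D r m n) ->
        {ae P, forall w,
          (1 <= limn_einf (fun n => (ln (WH D X lam n w) / uH D r m n)%:E))%E} &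
      forall alpha : R, 0 < alpha -> alpha < 1 ->
        (\int[P]_w tauH D X lam alpha w
           <= rho + varrho1 + (pi ^+ 2 / 3)%:E
              + aleph (uH D r m) (ln (1 / alpha)))%E].
Proof.
pose E n := [set w | ln (WH D X lam n w) < uH D r m n].
pose A n := [set w | ((r n)%:E < regretH D X lam n w)%E].
pose B n := [set w | norm2 (mean_cond EX n w) < m n].
pose q n : R := Num.min 1 (2 / n%:R ^+ 2).
have mX t j : measurable_fun setT (fun w => X t w ord0 j).
  exact: (measurable_adapted_coord hF j (X_adapted t)).
have mlam t j : measurable_fun setT (fun w => lam t.+1 w ord0 j).
  exact: (measurable_adapted_coord hF j (lam_predictable t)).
have mEX t j : measurable_fun setT (fun w => EX t.+1 w ord0 j).
  by case: (hEX t) => mY _ _; exact: (measurable_adapted_coord hF j mY).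
have mW n : measurable_fun setT (fun w => ln (WH D X lam n w)).
  exact: measurable_ln_WH.
have mE n : measurable (E n) by exact: measurable_lt_set.
have mA n : measurable (A n) by exact: measurable_regretH_gt.
have mmu n j : measurable_fun setT (fun w => mean_cond EX n w ord0 j).
  under eq_fun do rewrite /mean_cond mxE.
  by apply: measurable_funM => //; exact: measurable_coord_sum.
have mB n : measurable (B n).
  by apply: measurable_lt_set => //; exact: measurable_norm2.
have q0 n : (0 <= (q n)%:E)%E.
  by rewrite lee_fin le_min ler01 divr_ge0// exprn_ge0.
have Xp := X_in 0%N point.
have Dge0 : 0 <= D.
  by rewrite hD (le_trans (norm2_ge0 _) (norm2_le_diam2 hXX Xp Xp)).
have PE n : (0 < n)%N -> (P (E n) <= P (A n) + P (B n) + (q n)%:E)%E.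
  move=> n0; move: Dge0; rewrite le_eqVlt => /predU1P[D0|D0].
    (* Division by D ^+ 2 = 0 gives 0, so that uH D r m n = - r n here. *)
    apply: (@le_trans _ _ (P (A n))).
      apply: le_measure; rewrite ?inE// => w; rewrite /E /A /= => Ew.
      apply/regretH_gtP; exists 0; move: Ew.
      rewrite /uH ln_LHE -D0 dotpC dotp0r norm20 !expr0n.
      rewrite !mul0r !mulr0 invr0 mulr0.
      by lra.
    by rewrite -addeA leeDl// adde_ge0.
  pose delta := 2 * D * Num.sqrt (ln n%:R / n%:R).
  pose C := [set w | delta <
    norm2 (n%:R^-1 *: \sum_(1 <= t < n.+1) X t w - mean_cond EX n w)].
  have mC : measurable C.
    apply: measurable_lt_set => //; apply: measurable_norm2 => j.
    under eq_fun do rewrite 2!mxE [X in _ + X]mxE.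
    apply: measurable_funB => //; apply: measurable_funM => //.
    exact: measurable_coord_sum.
  have PC : (P C <= (q n)%:E)%E.
    rewrite EFin_min le_min probability_le1//=.
    have := mean_tail hF hXX X_in X_adapted hEX; rewrite -hD.
    by apply.
  apply: (@le_trans _ _ (P (A n `|` B n) + P C)%E).
    apply: (@le_trans _ _ (P (A n `|` B n `|` C))); last first.
      by apply: measureU2 => //; exact: measurableU.
    apply: le_measure; rewrite ?inE//; first by do 2?apply: measurableU.
    move=> w Ew; apply: contrapT => nABC; move: Ew; rewrite /E /= ltNge.
    move/negP; apply; apply: (ln_WH_ge n0 D0 (mu := mean_cond EX n w)).
    - by rewrite leNgt; apply/negP => h; apply: nABC; left; left.
    - by rewrite leNgt; apply/negP => h; apply: nABC; left; right.
    - by rewrite leNgt; apply/negP => h; apply: nABC; right.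
  by rewrite leeD// measureU2.
have sumE : (\sum_(1 <= n <oo) P (E n) <= rho + varrho1 + (pi ^+ 2 / 3)%:E)%E.
  apply: (@le_trans _ _ (\sum_(1 <= n <oo) (P (A n) + P (B n) + (q n)%:E))%E).
    rewrite -!(nneseries_addn 1)//; last by move=> n; rewrite !adde_ge0.
    by apply: lee_nneseries => // n _; apply: PE; rewrite addn1.
  rewrite nneseriesD//; last by move=> n _ _; rewrite adde_ge0.
  rewrite nneseriesD// -rhoE -varrho1E leeD2l//.
  exact: sum_min_inv_sqr_le.
have bound_fin : (rho + varrho1 + (pi ^+ 2 / 3)%:E < +oo)%E.
  by rewrite !lte_add_pinfty// ltry.
split => //.
- move=> u0.
  (* The event E 0 is not part of the series, hence the replacement by set0. *)
  apply: (ae_limn_einf_ge1 (E := fun n => if n is 0 then set0 else E n)).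
  + by case.
  + rewrite nneseries_recl// measure0 add0e.
    apply: le_lt_trans bound_fin; apply: le_trans sumE.
    rewrite -!(nneseries_addn 1)//; apply: lee_nneseries => // n _.
    by rewrite addn1.
  + near=> n => w.
    have n0 : (0 < n)%N by near: n; exact: nbhs_infty_gt.
    have un : 0 < uH D r m n by near: n.
    move=> nE; have {}nE : ~ E n w by case: (n) n0 nE.
    by rewrite ler_pdivlMr// mul1r leNgt; apply/negP.
- move=> alpha a0 a1; rewrite /aleph; set Sn := [set n%:R%:E | n in _].
  have bound_ge0 : (0 <= rho + varrho1 + (pi ^+ 2 / 3)%:E)%E.
    by apply: le_trans sumE; exact: nneseries_ge0.
  have bound_fin_num : rho + varrho1 + (pi ^+ 2 / 3)%:E \is a fin_num.
    by rewrite ge0_fin_numE.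
  rewrite -leeBlDl//; apply: le_ereal_inf_tmp => _ [N [N1 uN] <-].
  rewrite leeBlDl// addeC.
  apply: (@le_trans _ _ (N%:R%:E + \sum_(N <= n <oo) P (E n))%E).
    apply: integral_first_time_le => // [w|w n Nn nE].
      by apply: le_ereal_inf_tmp => _ [n _ <-]; rewrite lee_fin.
    apply: ereal_inf_lbound; exists n => //=.
    rewrite -ler_ln ?posrE ?divr_gt0 ?WH_gt0// -lee_fin.
    apply: (le_trans uN); apply: (@le_trans _ _ (uH D r m n)%:E).
      by apply: ereal_inf_lbound; exists n.
    by rewrite lee_fin leNgt; apply/negP.
  rewrite leeD2l//; apply: le_trans sumE.
  rewrite (nneseries_split 1 N.-1)// add1n prednK// leeDr//.
  exact: sume_ge0.
Unshelve. all: by end_near. Qed.
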